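(* Let $G$ be a connected weighted graph of order $n\ge 3$ and let $\mathcal P=\{V_1,\dots,V_m\}$ be a partition of $V(G)$ into $m$ nonempty parts, where $2\le m\le n-1$. Let $1=\theta_1>\theta_2\ge\cdots\ge\theta_m$ be the eigenvalues of the degree-weighted quotient matrix $B=B(\mathcal P)$, and put $\tau=\tau(\mathcal P)=\operatorname{tr}B(\mathcal P)$ and $M=M_G$ (the normalized adjacency matrix of $G$). Then $$K(G)\ \ge\ \sum_{i=2}^{m}\frac{1}{1-\theta_i}+\frac{(n-m)^2}{n-m+\tau},$$ with equality if and only if $\operatorname{Spec}(M)=\operatorname{Spec}(B)\uplus\{\rho^{(n-m)}\}$, where $\rho=-\tau/(n-m)$.
   Context: Graphs are finite, simple, connected, undirected and weighted: $G=(V,E,c)$ with symmetric weights $c(i,j)=c_{ij}=c_{ji}>0$ if $\{i,j\}\in E$ and $c_{ij}=0$ otherwise (no loops), $|V|=n$. The degree of vertex $i$ is $k_i=\sum_j c_{ij}$, $D=\operatorname{diag}(k_1,\dots,k_n)$, $A=(c_{ij})$ is the adjacency matrix, and $\operatorname{vol}(S)=\sum_{i\in S}k_i$ for $S\subseteq V$. The normalized adjacency matrix is $M_G=D^{-1/2}AD^{-1/2}$, with eigenvalues $1=\lambda_1>\lambda_2\ge\cdots\ge\lambda_n\ge-1$. Kemeny's constant is $K(G)=\sum_i\pi_i m_{ji}-1$ for the random walk with transition matrix $D^{-1}A$, where $\pi$ is the stationary distribution and $m_{ji}$ the mean first passage time from $j$ to $i$ (with $m_{jj}$ the mean first return time);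 this does not depend on $j$, and it is known that $K(G)=\sum_{j=2}^{n}\frac{1}{1-\lambda_j}$. For a partition $\mathcal P=\{V_1,\dots,V_m\}$ of $V(G)$ into nonempty parts, the degree-weighted quotient matrix $B=B(\mathcal P)$ is the $m\times m$ symmetric matrix with entries $B_{ii}=\frac{2e(V_i)}{\operatorname{vol}(V_i)}$ and $B_{ij}=\frac{e(V_i,V_j)}{\sqrt{\operatorname{vol}(V_i)\operatorname{vol}(V_j)}}$ for $i\ne j$, where $e(V_i,V_j)=\sum_{u\in V_i,v\in V_j}c_{uv}$ and $e(V_i)=\sum_{\{u,v\}\subseteq V_i}c_{uv}$. Put $\tau(\mathcal P)=\operatorname{tr}B(\mathcal P)=\sum_{i=1}^m\frac{2e(V_i)}{\operatorname{vol}(V_i)}$. $\operatorname{Spec}$ denotes the multiset of eigenvalues (with multiplicity), $\uplus$ is multiset union, and $\rho^{(k)}$ means $\rho$ repeated $k$ times. *)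

(* Defs.v *)
From HB Require Import structures.
From mathcomp Require Import all_boot all_order all_algebra.
From mathcomp Require Import reals ereal topology sequences.

Set Implicit Arguments.
Unset Strict Implicit.
Unset Printing Implicit Defensive.

Import Order.TTheory GRing.Theory Num.Theory.

Local Open Scope ring_scope.

(* A finite simple weighted graph on the vertices 'I_n, given by its weighted
   adjacency matrix; {i, j} is an edge iff 0 < c i j. *)
Record wgraph (R : realType) (n : nat) := WGraph {
  adj :> 'M[R]_n;
  adj_sym : forall i j, adj i j = adj j i;
  adj_ge0 : forall i j, 0 <= adj i j;
  adj_loopless : forall i, adj i i = 0
}.

Section Defs.
Variables (R : realType) (n : nat).

Definition edge (G : wgraph R n) : rel 'I_n := [rel i j | 0 < G i j].

Definition graph_connected (G : wgraph R n) : Prop :=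
  forall i j, connect (edge G) i j.

Definition deg (G : wgraph R n) (i : 'I_n) : R := \sum_j G i j.

Definition vol (G : wgraph R n) (S : {set 'I_n}) : R := \sum_(i in S) deg G i.

Definition cut_weight (G : wgraph R n) (S T : {set 'I_n}) : R :=
  \sum_(u in S) \sum_(v in T) G u v.

(* Each unordered pair {u, v} inside S is counted once, as u < v. *)
Definition inner_weight (G : wgraph R n) (S : {set 'I_n}) : R :=
  \sum_(u in S) \sum_(v in S | (u < v)%N) G u v.

Definition normalized_adj (G : wgraph R n) : 'M[R]_n :=
  let Dis := diag_mx (\row_i (Num.sqrt (deg G i))^-1) in Dis *m G *m Dis.

Definition transition (G : wgraph R n) : 'M[R]_n :=
  diag_mx (\row_i (deg G i)^-1) *m G.

Definition stationary (P : 'M[R]_n) (p : 'rV[R]_n) : Prop :=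
  [/\ forall i, 0 <= p 0 i, \sum_i p 0 i = 1 & p *m P = p].

(* Probability that the chain with transition matrix P, started at j, is at i
   at time t + 1 and at no time in 1, ..., t: the law of the first passage time
   (of the first return time when j = i), shifted by one. *)
Fixpoint first_passage (P : 'M[R]_n) (i : 'I_n) (t : nat) (j : 'I_n) : R :=
  if t is s.+1 then \sum_(k | k != i) P j k * first_passage P i s k
  else P j i.

(* m_{ji}, as an extended real so that the expectation is always meaningful;
   on a connected graph the first passage time is almost surely finite, so no
   mass at infinity is missed by the sum. *)
Definition mean_first_passage (P : 'M[R]_n) (j i : 'I_n) : \bar R :=
  (\sum_(0 <= t <oo) (t.+1%:R * first_passage P i t j)%:E)%E.

(* Kemeny's constant computed from the stationary distribution p and the
   starting vertex j. *)
Definition kemeny (G : wgraph R n) (p : 'rV[R]_n) (j : 'I_n) : \bar R :=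
  (\sum_i (p 0 i)%:E * mean_first_passage (transition G) j i - 1)%E.

(* V_1, ..., V_m are the distinct parts of a partition of the vertex set;
   nonemptiness of the parts is included in [partition]. *)
Definition vertex_partition m (V : 'I_m -> {set 'I_n}) : Prop :=
  injective V /\ partition [set V i | i : 'I_m] [set: 'I_n].

Definition quotient_mx (G : wgraph R n) m (V : 'I_m -> {set 'I_n}) : 'M[R]_m :=
  \matrix_(i, j)
    if i == j then 2 * inner_weight G (V i) / vol G (V i)
    else cut_weight G (V i) (V j) / Num.sqrt (vol G (V i) * vol G (V j)).

Definition tau (G : wgraph R n) m (V : 'I_m -> {set 'I_n}) : R :=
  \tr (quotient_mx G V).

End Defs.

(* s lists the eigenvalues of A with (algebraic) multiplicity, in some order;
   [perm_eq] is then equality of spectra as multisets and [++] their union. *)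
Definition spectrum (R : realType) k (A : 'M[R]_k) (s : k.-tuple R) : Prop :=
  char_poly A = \prod_(x <- s) ('X - x%:P).

(* Main.v *)
Require Import Defs.
From mathcomp Require Import all_boot all_order all_algebra.
From mathcomp Require boolp.
From mathcomp Require Import reals ereal topology normedtype sequences.
From mathcomp Require Import ring lra.

Set Implicit Arguments.
Unset Strict Implicit.
Unset Printing Implicit Defensive.

Import Order.TTheory GRing.Theory Num.Theory.

Local Open Scope ring_scope.

(* Let w be the unit Perron vector of M and N = 1 - M + w w^T, which is positive
   definite because G is connected.  The mean first passage times are
   (delta_ij + z_ii - z_ji) / pi_i, where (z_ij) = D^(-1/2) N^(-1) D^(1/2), and
   hence K(G) = tr N^(-1) - 1.

   The degree-weighted indicators of the parts form an isometry S with
   B = S^T M S, whose range contains w; the compression N1 = S^T N S therefore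
   plays the role of N for B.  With a = tr N - tr N1 = n - m + tau and
   X = S N1^(-1) S^T + ((n - m) / a) (1 - S S^T),
     0 <= tr ((N^(-1) - X) N (N^(-1) - X))
        = tr N^(-1) - tr N1^(-1) - (n - m)^2 / a,
   which is the bound.  Equality forces N^(-1) = X, that is
   M = S B S^T + rho (1 - S S^T), whose spectrum is Spec(B) and n - m copies of
   rho; conversely that spectrum determines K(G). *)

(** * Symmetric matrices with split characteristic polynomial *)

(** Unique factorization into linear factors; it converts equal characteristic polynomials into
    equal multisets of eigenvalues. *)
Lemma prod_XsubC_inj (F : fieldType) (s t : seq F) :
  \prod_(x <- s) ('X - x%:P) = \prod_(x <- t) ('X - x%:P) -> perm_eq s t.
Proof.
elim: s t => [|x s IHs] t st.
  have := congr1 (fun p : {poly F} => size p) st.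
  rewrite !size_prod_XsubC; case: t {st} => //=.
have tx : x \in t by rewrite -root_prod_XsubC -st root_prod_XsubC mem_head.
rewrite perm_sym (perm_trans (perm_to_rem tx)) // perm_cons perm_sym.
apply: IHs; move: st; rewrite (perm_big _ (perm_to_rem tx)) !big_cons /=.
by apply: mulfI; rewrite polyXsubC_eq0.
Qed.

Section Deflation.
Variable R : rcfType.

Lemma char_poly_conj n (H M : 'M[R]_n) :
  H *m H = 1%:M -> char_poly (H *m M *m H) = char_poly M.
Proof.
move=> HH.
have HHp : map_mx polyC H *m map_mx polyC H = 1%:M by rewrite -map_mxM HH map_mx1.
rewrite /char_poly.
have -> : char_poly_mx (H *m M *m H)
    = map_mx polyC H *m char_poly_mx M *m map_mx polyC H.
  rewrite /char_poly_mx mulmxBr mulmxBl !map_mxM mul_mx_scalar -scalemxAl HHp.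
  by rewrite scalemx1.
by rewrite !det_mulmx mulrAC -det_mulmx HHp det1 mul1r.
Qed.

Lemma char_poly_block_diag m n (A : 'M[R]_m) (B : 'M[R]_n) :
  char_poly (block_mx A 0 0 B) = char_poly A * char_poly B.
Proof.
rewrite /char_poly /char_poly_mx map_block_mx !map_mx0 (scalar_mx_block m n).
by rewrite opp_block_mx add_block_mx !oppr0 !addr0 det_ublock.
Qed.

Lemma char_poly1 (a : R) : char_poly (a%:M : 'M_1) = 'X - a%:P.
Proof. by rewrite /char_poly det_mx11 !mxE eqxx !mulr1n. Qed.

Lemma mx11_norm2 n (v : 'cV[R]_n) : (v^T *m v) 0 0 = \sum_i v i 0 ^+ 2.
Proof. by rewrite !mxE; apply: eq_bigr => i _; rewrite !mxE expr2. Qed.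

Lemma norm2_eq0 n (v : 'cV[R]_n) : ((v^T *m v) 0 0 == 0) = (v == 0).
Proof.
apply/eqP/eqP => [|->]; last by rewrite mulmx0 mxE.
rewrite mx11_norm2 => /eqP.
rewrite psumr_eq0 => [/allP v0|i _]; last exact: sqr_ge0.
apply/matrixP => i j; rewrite !ord1 mxE.
by apply/eqP; rewrite -sqrf_eq0; apply: v0; rewrite mem_index_enum.
Qed.

(** Take the reflection in the hyperplane orthogonal to [w - v], or the identity when this vector
    vanishes. *)
Lemma householder n (v w : 'cV[R]_n) :
  v^T *m v = 1%:M -> w^T *m w = 1%:M ->
  exists H : 'M[R]_n, [/\ H^T = H, H *m H = 1%:M & H *m w = v].
Proof.
move=> vv ww; have [<-|wv] := eqVneq w v.
  by exists 1%:M; rewrite trmx1 !mul1mx.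
have [u uE] : exists u : 'cV[R]_n, u = w - v by exists (w - v).
pose d := (u^T *m u) 0 0.
have d0 : d != 0 by rewrite norm2_eq0 uE subr_eq0.
have uu : u^T *m u = d%:M by rewrite [LHS]mx11_scalar.
(* As [v] and [w] have equal length, the inner product of [u] and [w] is half of the squared length
   of [u]; hence the reflection subtracts exactly [u] from [w]. *)
have dE : d%:M = 2 *: (u^T *m w).
  have vw : v^T *m w = w^T *m v.
    rewrite -[LHS]trmxK [(v^T *m w)^T]trmx_mul trmxK.
    by rewrite [LHS]mx11_scalar mxE -mx11_scalar.
  rewrite -uu uE mulmxBr [(w - v)^T]linearB /= !mulmxBl vv ww vw.
  by rewrite scaler_nat mulr2n -[_ - 1%:M]opprB opprK.
exists (1%:M - (2 / d) *: (u *m u^T)); split.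
- by rewrite linearB /= trmx1 linearZ /= trmx_mul trmxK.
- rewrite mulmxBr !mulmxBl !mul1mx mulmx1 -!scalemxAl -!scalemxAr.
  rewrite mulmxA -[u *m u^T *m u]mulmxA uu mul_mx_scalar -scalemxAl !scalerA.
  have -> : 2 / d * (2 / d * d) = 2 / d + 2 / d by field.
  by rewrite scalerDl opprB addrK subrK.
- rewrite mulmxBl mul1mx -scalemxAl -mulmxA.
  have -> : u^T *m w = (d / 2)%:M.
    apply: (@scalerI R _ 2); first by rewrite pnatr_eq0.
    by rewrite -dE scale_scalar_mx mulrC divfK // pnatr_eq0.
  rewrite mul_mx_scalar scalerA.
  have -> : 2 / d * (d / 2) = 1 by field.
  by rewrite scale1r uE opprB addrC subrK.
Qed.

(** After a reflection taking [w] to the first basis vector, the eigenvector equation fixes the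
    first column, and symmetry clears the rest of the first row. *)
Lemma deflate k (M : 'M[R]_(1 + k)) (a : R) (w : 'cV[R]_(1 + k)) :
  M^T = M -> w^T *m w = 1%:M -> M *m w = a *: w ->
  exists (H : 'M[R]_(1 + k)) (M' : 'M[R]_k),
    [/\ H *m H = 1%:M, H *m w = col_mx 1%:M 0, w^T *m H = row_mx 1%:M 0,
        M'^T = M' & H *m M *m H = block_mx a%:M 0 0 M'].
Proof.
move=> Ms ww Mw; pose e := col_mx 1%:M 0 : 'cV[R]_(1 + k).
have ee : e^T *m e = 1%:M.
  by rewrite tr_col_mx mul_row_col trmx1 trmx0 mul1mx mul0mx addr0.
have [H [Hs HH Hw]] := householder ee ww.
exists H, (drsubmx (H *m M *m H)).
have Ns : (H *m M *m H)^T = H *m M *m H by rewrite !trmx_mul Hs Ms mulmxA.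
have Ne : H *m M *m H *m e = a *: e.
  rewrite -Hw -[H *m M *m H *m _]mulmxA [H *m (H *m w)]mulmxA HH mul1mx.
  by rewrite -mulmxA Mw scalemxAr.
split=> //; first by rewrite -[LHS]trmxK trmx_mul trmxK Hs Hw tr_col_mx trmx1 trmx0.
  by rewrite trmx_drsub Ns.
move: Ns Ne; rewrite /e; move: (H *m M *m H) => N.
rewrite -[N]submxK tr_block_mx => /eq_block_mx [_ Nur _ _].
rewrite mul_block_col !mulmx0 !mulmx1 !addr0 scale_col_mx scaler0.
move=> /eq_col_mx [-> Nd0].
by rewrite -Nur Nd0 trmx0 block_mxKdr scalemx1.
Qed.

Lemma invmx_unique n (A B : 'M[R]_n) : A *m B = 1%:M -> invmx A = B.
Proof.
move=> AB; have /mulmx1_unit[uA _] := AB.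
by rewrite -[LHS]mulmx1 -AB mulmxA mulVmx // mul1mx.
Qed.

Lemma mxtrace_inv_conj n (H A : 'M[R]_n) : H *m H = 1%:M -> A \in unitmx ->
  \tr (invmx (H *m A *m H)) = \tr (invmx A).
Proof.
move=> HH uA; rewrite (@invmx_unique _ _ (H *m invmx A *m H)).
  by rewrite mxtrace_mulC mulmxA HH mul1mx.
rewrite -!mulmxA [H *m (H *m _)]mulmxA HH mul1mx [A *m (_ *m _)]mulmxA.
by rewrite mulmxV // mul1mx.
Qed.

Lemma mxtrace_inv_block n (a : R) (A : 'M[R]_n) :
  block_mx (a%:M : 'M_1) 0 0 A \in unitmx ->
  A \in unitmx /\
  \tr (invmx (block_mx (a%:M : 'M_1) 0 0 A)) = a^-1 + \tr (invmx A).
Proof.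
move=> ub; move: (ub); rewrite unitmxE det_ublock unitrM => /andP[ua uA].
split; first by rewrite unitmxE.
rewrite invmx_block_diag // mxtrace_block invmx_scalar mxtrace_scalar //.
Qed.

Lemma conj_one_sub n (H A : 'M[R]_n) : H *m H = 1%:M ->
  H *m (1%:M - A) *m H = 1%:M - H *m A *m H.
Proof. by move=> HH; rewrite mulmxBr mulmxBl mulmx1 HH. Qed.

(** Induction on the list of eigenvalues: each head yields a unit eigenvector, and deflation leaves
    a smaller symmetric matrix whose characteristic polynomial splits over the tail. *)
Lemma mxtrace_inv_split k (M : 'M[R]_k) (s : seq R) : M^T = M ->
  char_poly M = \prod_(x <- s) ('X - x%:P) -> 1%:M - M \in unitmx ->
  \tr (invmx (1%:M - M)) = \sum_(x <- s) (1 - x)^-1.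
Proof.
elim: s k M => [|x s IHs] k M Ms Mc u1M.
  have := size_char_poly M; rewrite Mc big_nil size_poly1 => -[k0].
  by move: u1M; subst k; rewrite big_nil /mxtrace big_ord0.
have : root (char_poly M) x by rewrite Mc root_prod_XsubC mem_head.
rewrite -eigenvalue_root_char => /eigenvalueP[v vM v0].
case: k M v Ms Mc u1M vM v0 => [|k]; first by move=> M v _ _ _ _; rewrite thinmx0 eqxx.
rewrite -[k.+1]/(1 + k)%N => M v Ms Mc u1M vM v0.
pose d := (v^T^T *m v^T) 0 0.
have d0 : d != 0 by rewrite norm2_eq0 -trmx0 (inj_eq trmx_inj).
have dp : 0 < d by rewrite lt0r d0 /d mx11_norm2 sumr_ge0 // => i _; exact: sqr_ge0.
pose w : 'cV_(1 + k) := (Num.sqrt d)^-1 *: v^T.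
have ww : w^T *m w = 1%:M.
  rewrite /w [(_ *: _)^T]linearZ /= -scalemxAl -scalemxAr [v^T^T *m _]mx11_scalar -/d.
  rewrite scalerA -invfM -expr2 sqr_sqrtr ?ltW //.
  by rewrite scale_scalar_mx mulVf.
have Mw : M *m w = x *: w.
  rewrite /w -scalemxAr -[M]Ms.
  by rewrite -trmx_mul vM linearZ /= scalerA mulrC -scalerA.
have [H [M' [HH _ _ M's HM]]] := deflate Ms ww Mw.
rewrite -(mxtrace_inv_conj HH u1M) conj_one_sub // HM.
have blockE : 1%:M - block_mx (x%:M : 'M_1) 0 0 M'
    = block_mx ((1 - x)%:M : 'M_1) 0 0 (1%:M - M').
  by rewrite (scalar_mx_block 1 k) opp_block_mx add_block_mx !oppr0 !addr0 -raddfB.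
rewrite blockE; move: Mc.
rewrite -(char_poly_conj M HH) HM char_poly_block_diag big_cons char_poly1.
move=> /mulfI -/(_ (negbT (polyXsubC_eq0 x))) M'c.
have ub : block_mx ((1 - x)%:M : 'M_1) 0 0 (1%:M - M') \in unitmx.
  rewrite -blockE -HM -conj_one_sub // !unitmx_mul u1M.
  by have [-> _] := mulmx1_unit HH.
have [u1M' ->] := mxtrace_inv_block ub.
by rewrite big_cons (IHs _ _ M's M'c u1M').
Qed.

(** The regularized matrix is the identity on [w] and [1 - M] on the orthogonal complement, so
    exactly one eigenvalue 1 of [M] is replaced by a summand 1. This serves both the graph and its
    quotient. *)
Lemma mxtrace_inv_perron k (M : 'M[R]_k) (w : 'cV[R]_k) (s : seq R) :
  M^T = M -> w^T *m w = 1%:M -> M *m w = w ->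
  char_poly M = \prod_(x <- s) ('X - x%:P) ->
  1%:M - M + w *m w^T \in unitmx ->
  1 \in s /\
  \tr (invmx (1%:M - M + w *m w^T)) = 1 + \sum_(x <- rem 1 s) (1 - x)^-1.
Proof.
case: k M w => [|k]; last rewrite -[k.+1]/(1 + k)%N; move=> M w Ms ww Mw Mc uN.
  move: ww; rewrite flatmx0 thinmx0 mulmx0 => /matrixP/(_ 0 0); rewrite !mxE.
  by move=> /esym/eqP; rewrite oner_eq0.
have Mw' : M *m w = 1 *: w by rewrite scale1r.
have [H [M' [HH Hw wH M's HM]]] := deflate Ms ww Mw'.
have s1 : 1 \in s.
  rewrite -root_prod_XsubC -Mc -(char_poly_conj M HH) HM char_poly_block_diag.
  by rewrite char_poly1 rootM root_XsubC eqxx.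
split=> //.
move: Mc; rewrite -(char_poly_conj M HH) HM char_poly_block_diag char_poly1.
rewrite (perm_big _ (perm_to_rem s1)) big_cons /=.
move=> /mulfI -/(_ (negbT (polyXsubC_eq0 _))) M'c.
have NE : H *m (1%:M - M + w *m w^T) *m H = block_mx (1%:M : 'M_1) 0 0 (1%:M - M').
  rewrite mulmxDr mulmxDl conj_one_sub // HM mulmxA Hw -mulmxA wH.
  rewrite mul_col_row !mulmx1 !mulmx0.
  rewrite (scalar_mx_block 1 k) opp_block_mx !add_block_mx !oppr0 !addr0.
  by rewrite subrr add0r.
rewrite -(mxtrace_inv_conj HH uN) NE.
have ub : block_mx (1%:M : 'M_1) 0 0 (1%:M - M') \in unitmx.
  rewrite -NE !unitmx_mul uN.
  by have [-> _] := mulmx1_unit HH.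
have [u1M' ->] := mxtrace_inv_block ub.
by rewrite invr1 (mxtrace_inv_split M's M'c u1M').
Qed.

End Deflation.

(** * Compressions of positive definite matrices *)

(** Sylvester's determinant identity: eliminate either off-diagonal product from the block matrix
    [K]. The powers of [y] avoid division, so that [y] may be a polynomial. *)
Lemma det_scalar_sub_mulC (R : comNzRingType) m n (S : 'M[R]_(n, m))
    (T : 'M[R]_(m, n)) (y : R) :
  \det (y%:M - S *m T) * y ^+ m = \det (y%:M - T *m S) * y ^+ n.
Proof.
pose K := block_mx 1%:M T S y%:M.
have detK : \det K = \det (y%:M - S *m T).
  have := det_mulmx (block_mx 1%:M 0 (- S) 1%:M) K.
  rewrite det_lblock !det1 !mul1r => <-.
  rewrite mulmx_block !mul1mx !mul0mx !addr0 mulmx1 addNr mulNmx addrC.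
  by rewrite det_ublock det1 mul1r addrC.
rewrite -detK -!det_scalar -[\det (y%:M : 'M_m)]mulr1 -(det1 R n).
rewrite -(det_lblock _ (- S)) -det_mulmx mulmx_block.
rewrite !mul1mx !mulmx1 !mulmx0 !add0r mulmxN mul_mx_scalar mul_scalar_mx.
by rewrite scalerN subrr det_ublock.
Qed.

(** The matrix equals [rho + S (B - rho) S^T], so Sylvester's identity at [y = 'X - rho] moves the
    product to size [m], where [S^T S = 1] removes [S]. *)
Lemma char_poly_isometry (R : fieldType) m n (S : 'M[R]_(n, m)) (B : 'M[R]_m)
    (rho : R) : (m <= n)%N -> S^T *m S = 1%:M ->
  char_poly (S *m B *m S^T + rho *: (1%:M - S *m S^T))
    = char_poly B * ('X - rho%:P) ^+ (n - m).
Proof.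
move=> le_mn SS; pose y : {poly R} := 'X - rho%:P.
have y0 : y ^+ m != 0 by rewrite expf_neq0 // polyXsubC_eq0.
apply: (mulIf y0); rewrite -mulrA -exprD subnK //.
pose Sp := map_mx polyC S; pose T := map_mx polyC ((B - rho%:M) *m S^T).
have -> : char_poly B = \det (y%:M - T *m Sp).
  congr (\det _); rewrite -map_mxM -mulmxA SS mulmx1 /char_poly_mx /y.
  by rewrite map_mxB map_scalar_mx raddfB /= opprB addrA subrK.
rewrite -det_scalar_sub_mulC; congr (\det _ * _).
rewrite -map_mxM /char_poly_mx /y [('X - rho%:P)%:M]raddfB /=.
have <- : map_mx polyC rho%:M = (rho%:P)%:M :> 'M_n by rewrite map_scalar_mx.
rewrite -addrA -opprD.
rewrite -map_mxD; congr (_ - map_mx _ _).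
rewrite mulmxBl mulmxBr mulmxA mul_scalar_mx -scalemxAr scalerBr scalemx1.
by rewrite addrCA.
Qed.

Section Posdef.
Variable R : rcfType.

Definition posdef n (N : 'M[R]_n) :=
  N^T = N /\ forall x : 'cV_n, x != 0 -> 0 < (x^T *m N *m x) 0 0.

Lemma posdef_unitmx n (N : 'M[R]_n) : posdef N -> N \in unitmx.
Proof.
move=> [Ns Np]; rewrite -row_free_unit -kermx_eq0; apply/eqP/row_matrixP => i.
rewrite row0; apply/eqP/negPn/negP => k0.
have := Np (row i (kermx N))^T; rewrite -trmx0 (inj_eq trmx_inj) => /(_ k0).
by rewrite trmxK -row_mul mulmx_ker row0 mul0mx mxE ltxx.
Qed.

Lemma posdef_compress m n (N : 'M[R]_n) (S : 'M[R]_(n, m)) :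
  posdef N -> S^T *m S = 1%:M -> posdef (S^T *m N *m S).
Proof.
move=> [Ns Np] SS; split=> [|x x0]; first by rewrite !trmx_mul trmxK Ns mulmxA.
have := Np (S *m x); rewrite trmx_mul !mulmxA; apply.
by apply: contra_neq x0 => Sx; rewrite -[x]mul1mx -SS -mulmxA Sx mulmx0.
Qed.

Lemma mxtrace_congr n k (N : 'M[R]_n) (Y : 'M[R]_(n, k)) :
  \tr (Y^T *m N *m Y) = \sum_i ((col i Y)^T *m N *m col i Y) 0 0.
Proof.
apply: eq_bigr => i _; rewrite tr_col -row_mul !mxE.
by apply: eq_bigr => l _; rewrite !mxE.
Qed.

Lemma posdef_mxtrace_gt0 n k (N : 'M[R]_n) (Y : 'M[R]_(n, k)) :
  posdef N -> Y != 0 -> 0 < \tr (Y^T *m N *m Y).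
Proof.
move=> [_ Np] Y0; rewrite mxtrace_congr.
have ge0 i : 0 <= ((col i Y)^T *m N *m col i Y) 0 0.
  have [->|/Np/ltW//] := eqVneq (col i Y) 0.
  by rewrite trmx0 !mul0mx mxE.
rewrite lt0r sumr_ge0 ?andbT => [|i _]; last exact: ge0.
apply: contra_neq Y0 => /eqP; rewrite psumr_eq0 => [/allP Y0|i _]; last exact: ge0.
apply/matrixP => a b; rewrite mxE.
have /eqP cb : col b Y == 0.
  apply/negPn/negP => /Np; rewrite (eqP (Y0 b (mem_index_enum _))).
  by rewrite ltxx.
by have /matrixP/(_ a 0) := cb; rewrite !mxE.
Qed.

(* The gap is the trace of (N^-1 - X) N (N^-1 - X), where X is the inverse of
   the compression of N to the range of S plus a multiple of the complementary
   projection. *)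
Lemma mxtrace_inv_compress m n (N : 'M[R]_n) (S : 'M[R]_(n, m)) :
  posdef N -> S^T *m S = 1%:M -> (m < n)%N ->
  let N1 := S^T *m N *m S in
  let a := \tr N - \tr N1 in
  [/\ 0 < a,
      \tr (invmx N1) + (n - m)%:R ^+ 2 / a <= \tr (invmx N) &
      \tr (invmx N) = \tr (invmx N1) + (n - m)%:R ^+ 2 / a ->
      N = S *m N1 *m S^T + (a / (n - m)%:R) *: (1%:M - S *m S^T)].
Proof.
move=> Np SS lt_mn N1 a.
pose E := 1%:M - S *m S^T; pose C := invmx N1.
have uN := posdef_unitmx Np.
have uN1 : N1 \in unitmx := posdef_unitmx (posdef_compress Np SS).
have Es : E^T = E by rewrite linearB /= trmx1 trmx_mul trmxK.
have ES : E *m S = 0 by rewrite mulmxBl mul1mx -mulmxA SS mulmx1 subrr.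
have SE : S^T *m E = 0 by rewrite -[S^T *m E]trmxK trmx_mul trmxK Es ES trmx0.
have EE : E *m E = E by rewrite {2}/E mulmxBr mulmx1 mulmxA ES mul0mx subr0.
have trE : \tr E = (n - m)%:R.
  by rewrite linearB /= mxtrace_mulC SS !mxtrace1 natrB // ltnW.
have r0 : (n - m)%:R != 0 :> R by rewrite pnatr_eq0 subn_eq0 -ltnNge.
(* By cyclicity [a] is the trace of [N] compressed to the complement of the range of [S]; it is
   positive because [E] has the nonzero trace [n - m]. *)
have trEN : \tr (E *m N) = a.
  by rewrite mulmxBl mul1mx linearB /= -mulmxA mxtrace_mulC.
have a_gt0 : 0 < a.
  rewrite -trEN -EE -mulmxA mxtrace_mulC -{1}Es; apply: posdef_mxtrace_gt0 => //.
  by apply: contra_neq r0 => E0; rewrite -trE E0 mxtrace0.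
have a0 : a != 0 by rewrite gt_eqF.
(* With [r = n - m], this [t] maximizes [2 t r - t^2 a], the share of the complement in
   [2 tr X - tr (X N X)]. *)
pose t := (n - m)%:R / a; pose X := S *m C *m S^T + t *: E.
have Cs : C^T = C by rewrite /C trmx_inv !trmx_mul trmxK (proj1 Np) mulmxA.
have Xs : X^T = X by rewrite linearD /= linearZ /= Es !trmx_mul trmxK Cs mulmxA.
have XX : X *m X = S *m C *m C *m S^T + t ^+ 2 *: E.
  rewrite mulmxDl !mulmxDr -!scalemxAl -!scalemxAr EE !mulmxA ES !mul0mx.
  rewrite -[_ *m S^T *m S]mulmxA SS mulmx1.
  rewrite -[_ *m S^T *m E]mulmxA SE mulmx0 !scaler0 addr0 add0r scalerA.
  by rewrite expr2.
have trX : \tr X = \tr C + t * (n - m)%:R.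
  rewrite linearD /= linearZ /= trE; congr (_ + _).
  by rewrite -mulmxA mxtrace_mulC -mulmxA SS mulmx1.
have trXNX : \tr (X *m N *m X) = \tr C + t ^+ 2 * a.
  rewrite -mulmxA mxtrace_mulC -mulmxA mxtrace_mulC XX.
  rewrite mulmxDl linearD /= -scalemxAl linearZ /= trEN; congr (_ + _).
  by rewrite -!mulmxA mxtrace_mulC -!mulmxA [S^T *m (N *m S)]mulmxA mulVmx // mulmx1.
have Zs : (invmx N)^T = invmx N by rewrite trmx_inv (proj1 Np).
pose Y := invmx N - X.
have Ys : Y^T = Y by rewrite linearB /= Zs Xs.
(* The expansion is [tr N^(-1) - 2 tr X + tr (X N X)], and this choice of [t] makes the traces of
   [X] and [X N X] agree. *)
have gap : \tr (Y^T *m N *m Y)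
    = \tr (invmx N) - (\tr C + (n - m)%:R ^+ 2 / a).
  rewrite Ys /Y mulmxBl mulVmx // !mulmxBr !mulmxBl mul1mx !linearB /=.
  rewrite mul1mx -[X *m N *m invmx N]mulmxA mulmxV // mulmx1 trXNX trX /t.
  by field.
have sub0 : \tr C + (n - m)%:R ^+ 2 / a <= \tr (invmx N).
  rewrite -subr_ge0 -gap; have [->|Y0] := eqVneq Y 0.
    by rewrite mulmx0 mxtrace0.
  exact/ltW/posdef_mxtrace_gt0.
split=> // eqZ.
have /eqP ZX : Y == 0.
  apply/negPn/negP => /(posdef_mxtrace_gt0 Np).
  by rewrite gap eqZ subrr ltxx.
have {}ZX : invmx N = X by apply/eqP; rewrite -subr_eq0 -/Y ZX.
(* Since [E S = 0] and [S^T E = 0], the matrix [X] is inverted separately on the range of [S] and on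
   its complement. *)
rewrite -[LHS]invmxK ZX -/E; apply: invmx_unique.
clearbody N1.
rewrite mulmxDl !mulmxDr -!scalemxAl -!scalemxAr EE !mulmxA ES !mul0mx.
rewrite -[_ *m S^T *m S]mulmxA SS mulmx1.
rewrite -[_ *m S^T *m E]mulmxA SE mulmx0 !scaler0 addr0 add0r scalerA.
rewrite -[S *m C *m N1]mulmxA mulVmx // mulmx1 /t.
have -> : (n - m)%:R / a * (a / (n - m)%:R) = 1 by rewrite mulrA divfK // divff.
by rewrite scale1r addrC subrK.
Qed.

End Posdef.

(** * First passage times *)

Lemma natr_mul_expr_le (R : realFieldType) (d : R) (T : nat) :
  0 <= d <= 1 -> T.+1%:R * (1 - d) * d ^+ T <= 1.
Proof.
move=> /andP[d0 d1].
(* The right side is [1 - d] times a geometric sum of [T.+1] terms, the smallest of which is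
   [d ^+ T]. *)
suff h : T.+1%:R * (1 - d) * d ^+ T <= 1 - d ^+ T.+1.
  by apply: le_trans h _; rewrite gerBl exprn_ge0.
elim: T => [|T IHT]; first by rewrite expr0 expr1; lra.
have u0 : 0 <= d ^+ T.+1 by rewrite exprn_ge0.
have u1 : d ^+ T.+1 <= 1 by rewrite exprn_ile1.
move: (ler_wpM2l d0 IHT); rewrite [d ^+ T.+2]exprS -[T.+2]addn1 natrD.
have -> : d * (T.+1%:R * (1 - d) * d ^+ T) = T.+1%:R * (1 - d) * d ^+ T.+1.
  by rewrite exprS; ring.
by nra.
Qed.

Import numFieldNormedType.Exports.
Local Open Scope classical_set_scope.

(** Write [g] as the square of [d]: one factor [d ^+ T] absorbs [T.+1] up to a constant, the other
    tends to 0. *)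
Lemma cvg_natr_mul_expr (R : realType) (g : R) : 0 <= g < 1 ->
  (fun T => T.+1%:R * g ^+ T) @ \oo --> (0 : R).
Proof.
move=> /andP[g0 g1]; pose d := Num.sqrt g.
have d0 : 0 <= d by rewrite sqrtr_ge0.
have d1 : d < 1 by rewrite -sqrtr1 ltr_sqrt.
have dg : g = d * d by rewrite -expr2 sqr_sqrtr.
have dT : (fun T => (1 - d)^-1 * d ^+ T) @ \oo --> (0 : R).
  by apply: cvg_geometric; rewrite ger0_norm.
apply: (squeeze_cvgr _ (cvg_cst 0) dT); near=> T.
rewrite mulr_ge0 ?ler0n ?exprn_ge0 //= dg exprMn.
rewrite mulrA ler_wpM2r ?exprn_ge0 // -[leRHS]mul1r ler_pdivlMr ?subr_gt0 //.
by rewrite mulrAC natr_mul_expr_le // d0 ltW.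
Unshelve. all: end_near.
Qed.

Section FirstPassage.
Variables (R : realType) (n : nat) (P : 'M[R]_n) (i : 'I_n).

(** The [t]-th power of [P] with column [i] set to zero, applied to [g]: the expectation of [g] at
    time [t] over paths from [j] that avoid [i] at times 1 to [t]. *)
Fixpoint killed_iter (g : 'I_n -> R) (t : nat) (j : 'I_n) : R :=
  if t is s.+1 then \sum_(k | k != i) P j k * killed_iter g s k else g j.

Hypothesis P_ge0 : forall j k, 0 <= P j k.
Hypothesis P_sum1 : forall j, \sum_k P j k = 1.

(* [killed_iter (fun=> 1) t j] is the probability that i is not hit by time t. *)
Lemma first_passageE t j : first_passage P i t j
  = killed_iter (fun=> 1) t j - killed_iter (fun=> 1) t.+1 j.
Proof.
elim: t j => [|t IHt] j.
  rewrite /=; under eq_bigr do rewrite mulr1.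
  by rewrite -(P_sum1 j) [in RHS](bigD1 i) //= addrK.
rewrite [LHS]/= [killed_iter _ t.+1 j]/= [killed_iter _ t.+2 j]/= -sumrB.
by apply: eq_bigr => k _; rewrite IHt mulrBr.
Qed.

(** Summation by parts: the first passage law is the decrement of the survival probability. *)
Lemma sum_first_passageE T j :
  \sum_(0 <= t < T) t.+1%:R * first_passage P i t j
  = \sum_(0 <= t < T) killed_iter (fun=> 1) t j
    - T%:R * killed_iter (fun=> 1) T j.
Proof.
elim: T => [|T IHT]; first by rewrite !big_geq // mul0r subr0.
rewrite !big_nat_recr // [LHS]/= IHT first_passageE -natr1.
by move: (killed_iter _ T.+1 j) => s'; rewrite /=; ring.
Qed.

Lemma killed_iter_le f g t j : (forall k, f k <= g k) ->
  killed_iter f t j <= killed_iter g t j.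
Proof.
move=> fg; elim: t j => [|t IHt] j //=.
by apply: ler_sum => k _; rewrite ler_wpM2l.
Qed.

Lemma killed_iterZ a g t j :
  killed_iter (fun k => a * g k) t j = a * killed_iter g t j.
Proof.
elim: t j => [|t IHt] j //=.
by rewrite mulr_sumr; apply: eq_bigr => k _; rewrite IHt mulrCA.
Qed.

Lemma killed_iterSr g t j :
  killed_iter g t.+1 j = killed_iter (killed_iter g 1) t j.
Proof.
elim: t j => [|t IHt] j //.
by rewrite [LHS]/= [RHS]/=; apply: eq_bigr => k _; rewrite -IHt.
Qed.

Variable h : 'I_n -> R.
Hypothesis hE : forall j, h j = 1 + \sum_(k | k != i) P j k * h k.

(* At a minimum point j of h the recursion gives h j * P j i >= 1. *)
Lemma hitting_ge1 j : 1 <= h j.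
Proof.
have [j0 _ min_j0] : exists2 j0, true & forall k, h j0 <= h k.
  by exists [arg min_(k < j) h k]%O => //; case: arg_minP => // k _ + l; apply.
have h0 : 0 < h j0.
  have h1 : 1 + h j0 * (1 - P j0 i) <= h j0.
    rewrite {2}hE lerD2l -(P_sum1 j0) (bigD1 i) //= addrC addrK mulr_sumr.
    by apply: ler_sum => k _; rewrite mulrC ler_wpM2l.
  rewrite ltNge; apply/negP => hle0.
  have := P_ge0 j0 i; nra.
rewrite hE lerDl sumr_ge0 // => k _; rewrite mulr_ge0 //.
exact: le_trans (ltW h0) (min_j0 k).
Qed.

Lemma killed_iter_hitting t j : killed_iter h t j
  = killed_iter (fun=> 1) t j + killed_iter h t.+1 j.
Proof.
elim: t j => [|t IHt] j; first exact: hE.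
rewrite [LHS]/= [killed_iter _ t.+1 j]/= [killed_iter _ t.+2 j]/= -big_split /=.
by apply: eq_bigr => k _; rewrite IHt mulrDr.
Qed.

Lemma hitting_expansion T j :
  h j = \sum_(0 <= t < T) killed_iter (fun=> 1) t j + killed_iter h T j.
Proof.
elim: T => [|T IHT]; first by rewrite big_geq // add0r.
by rewrite big_nat_recr //= -addrA -killed_iter_hitting.
Qed.

(** One killed step lowers [h] by 1, which is at least the fraction [L^-1] of [h] when [h <= L];
    iterate with ratio [1 - L^-1]. *)
Lemma killed_iter_geometric : exists2 g : R, 0 <= g < 1 &
  forall t j, killed_iter h t j <= g ^+ t * h j.
Proof.
have [L L1 hL] : exists2 L, 1 <= L & forall k, h k <= L.
  exists (1 + \sum_k h k) => [|k].
    by rewrite lerDl sumr_ge0 // => k _; apply: le_trans (hitting_ge1 k).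
  rewrite (bigD1 k) //= addrCA lerDl addr_ge0 // sumr_ge0 // => l _.
  exact: le_trans (hitting_ge1 l).
have L0 : 0 < L by apply: lt_le_trans L1.
exists (1 - L^-1).
  by rewrite subr_ge0 invf_le1 // L1 /= gtrBl invr_gt0.
elim=> [|t IHt] j; first by rewrite expr0 mul1r.
have le1 k : killed_iter h 1 k <= (1 - L^-1) * h k.
  have -> : killed_iter h 1 k = h k - 1 by rewrite [X in X - _]hE addrAC subrr add0r.
  by rewrite mulrBl mul1r lerD2l lerN2 mulrC ler_pdivrMr // mul1r.
rewrite killed_iterSr (le_trans (killed_iter_le _ _ le1)) // killed_iterZ exprS -mulrA.
by rewrite ler_wpM2l // subr_ge0 invf_le1.
Qed.

(** The partial sums miss [h j] by the tail [killed_iter h T j] and by the boundary term of the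
    summation by parts. As [h >= 1], survival is at most that tail, so geometric decay disposes of
    both. *)
Lemma mean_first_passageE j : mean_first_passage P j i = (h j)%:E.
Proof.
have [g g01 hg] := killed_iter_geometric; have /andP[g0 g1] := g01.
pose A T := \sum_(0 <= t < T) t.+1%:R * first_passage P i t j.
have s_ge0 T k : 0 <= killed_iter (fun=> 1) T k.
  elim: T k => [|T IHT] k //=.
  by rewrite sumr_ge0 // => l _; rewrite mulr_ge0.
have s_le T : killed_iter (fun=> 1) T j <= killed_iter h T j.
  by apply: killed_iter_le => k; apply: hitting_ge1.
have cA : A @ \oo --> h j.
  (* The tail costs at most one [g ^+ T * h j] and the boundary term at most [T] more. *)
  have lo : (fun T => h j - h j * (T.+1%:R * g ^+ T)) @ \oo --> h j.
    rewrite -[X in _ --> X]subr0 -[X in _ - X](mulr0 (h j)).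
    apply: cvgB; first exact: cvg_cst.
    by apply: cvgMr; exact: cvg_natr_mul_expr.
  apply: (squeeze_cvgr _ lo (cvg_cst (h j))); near=> T.
  rewrite /A sum_first_passageE.
  have := hitting_expansion T j; have := hg T j; have := s_le T; have := s_ge0 T j.
  have := ler0n R T; rewrite -natr1.
  move: (killed_iter _ T j) (killed_iter h T j) (\sum_(0 <= t < T) _) => s r a.
  move=> T0 s0 sr rg ha.
  have Ts0 : 0 <= T%:R * s by rewrite mulr_ge0.
  have Ts : T%:R * s <= T%:R * (g ^+ T * h j).
    by rewrite ler_wpM2l // (le_trans sr).
  by apply/andP; split; lra.
rewrite /mean_first_passage.
apply/cvg_lim => //.
rewrite (_ : (fun T => _) = EFin \o A).
  by apply: cvg_EFin => //; apply: nearW.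
by apply/boolp.funext => T /=; rewrite sumEFin.
Unshelve. all: end_near.
Qed.

End FirstPassage.

Local Close Scope classical_set_scope.

(** * The normalized adjacency matrix *)

Section Graph.
Variables (R : realType) (n : nat) (G : wgraph R n).
Hypotheses (n_gt1 : (1 < n)%N) (hG : graph_connected G).

Let W : R := vol G setT.

Definition perron : 'cV[R]_n := \col_u (Num.sqrt (deg G u) / Num.sqrt W).

Definition regularized_laplacian : 'M[R]_n :=
  1%:M - normalized_adj G + perron *m perron^T.

Let M := normalized_adj G.
Let N := regularized_laplacian.
Let w := perron.

(** A path from [u] to some other vertex starts with an edge at [u]. *)
Lemma deg_gt0 u : 0 < deg G u.
Proof.
have [v uv] : exists v : 'I_n, v != u.
  have : (1 < #|'I_n|)%N by rewrite card_ord.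
  move=> /card_gt1P[x [y [_ _ xy]]]; have [<-|xu] := eqVneq x u; last by exists x.
  by exists y; rewrite eq_sym.
have /connectP[[|x s] /= + vE] := hG u v; first by rewrite vE eqxx in uv.
move=> /andP[ux _]; apply: lt_le_trans (ux : 0 < G u x) _.
by rewrite /deg (bigD1 x) //= lerDl sumr_ge0 // => k _; apply: adj_ge0.
Qed.

Let sd_gt0 u : 0 < Num.sqrt (deg G u). Proof. by rewrite sqrtr_gt0 deg_gt0. Qed.
Let sd_neq0 u : Num.sqrt (deg G u) != 0. Proof. by rewrite gt_eqF. Qed.
Let sd_sqr u : Num.sqrt (deg G u) ^+ 2 = deg G u.
Proof. by rewrite sqr_sqrtr // ltW // deg_gt0. Qed.

Lemma volT_gt0 : 0 < W.
Proof.
have u : 'I_n by exists 0%N; apply: ltn_trans n_gt1.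
rewrite /W /vol (bigD1 u) ?inE //= ltr_pwDl ?deg_gt0 // sumr_ge0 // => v _.
exact/ltW/deg_gt0.
Qed.

Let sW_neq0 : Num.sqrt W != 0. Proof. by rewrite gt_eqF // sqrtr_gt0 volT_gt0. Qed.
Let sW_sqr : Num.sqrt W ^+ 2 = W.
Proof. by rewrite sqr_sqrtr // ltW // volT_gt0. Qed.

Lemma normalized_adjE u v :
  M u v = G u v / (Num.sqrt (deg G u) * Num.sqrt (deg G v)).
Proof. by rewrite /M /normalized_adj mul_mx_diag mul_diag_mx !mxE invfM; ring. Qed.

Lemma transitionE u v : transition G u v = G u v / deg G u.
Proof. by rewrite /transition mul_diag_mx !mxE mulrC. Qed.

Lemma transition_ge0 u v : 0 <= transition G u v.
Proof. by rewrite transitionE divr_ge0 ?adj_ge0 // ltW // deg_gt0. Qed.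

Lemma transition_sum1 u : \sum_v transition G u v = 1.
Proof.
under eq_bigr do rewrite transitionE.
by rewrite -mulr_suml divff // gt_eqF // deg_gt0.
Qed.

Lemma normalized_adj_sym : M^T = M.
Proof. by apply/matrixP => u v; rewrite mxE !normalized_adjE adj_sym [X in _ / X]mulrC. Qed.

Lemma normalized_adj_tr0 : \tr M = 0.
Proof. by rewrite /mxtrace big1 // => u _; rewrite normalized_adjE adj_loopless mul0r. Qed.

Lemma perron_unit : w^T *m w = 1%:M.
Proof.
rewrite [LHS]mx11_scalar mx11_norm2; congr _%:M.
under eq_bigr do rewrite mxE expr_div_n sd_sqr sW_sqr.
have -> : \sum_u deg G u / W = W / W.
  by rewrite -mulr_suml; congr (_ / _); apply: eq_bigl => u; rewrite inE.
by rewrite divff // gt_eqF // volT_gt0.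
Qed.

Lemma normalized_adj_perron : M *m w = w.
Proof.
apply/colP => u; rewrite !mxE.
transitivity (\sum_v G u v * ((Num.sqrt (deg G u))^-1 / Num.sqrt W)).
  apply: eq_bigr => v _; rewrite normalized_adjE mxE.
  by field; rewrite sW_neq0 !sd_neq0.
by rewrite -mulr_suml -/(deg G u) -{1}sd_sqr; field; rewrite sW_neq0 sd_neq0.
Qed.

(** The Dirichlet form; ordered pairs count each edge twice, whence the factor one half. *)
Lemma laplacian_form (x : 'cV[R]_n) : (x^T *m (1%:M - M) *m x) 0 0
  = 2^-1 * \sum_u \sum_v G u v
      * (x u 0 / Num.sqrt (deg G u) - x v 0 / Num.sqrt (deg G v)) ^+ 2.
Proof.
pose y u := x u 0 / Num.sqrt (deg G u).
have xMx : (x^T *m M *m x) 0 0 = \sum_u \sum_v G u v * (y u * y v).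
  rewrite -mulmxA mxE; apply: eq_bigr => u _; rewrite mxE mxE mulr_sumr.
  apply: eq_bigr => v _; rewrite normalized_adjE /y; field.
  by rewrite !sd_neq0.
have xx : (x^T *m x) 0 0 = \sum_u \sum_v G u v * y u ^+ 2.
  rewrite mx11_norm2; apply: eq_bigr => u _; rewrite -mulr_suml -/(deg G u).
  by rewrite /y expr_div_n sd_sqr mulrC divfK // gt_eqF // deg_gt0.
have xx' : (x^T *m x) 0 0 = \sum_u \sum_v G u v * y v ^+ 2.
  rewrite xx exchange_big; apply: eq_bigr => u _; apply: eq_bigr => v _.
  by rewrite adj_sym.
transitivity (2^-1 * ((x^T *m x) 0 0 + (x^T *m x) 0 0 - 2 * (x^T *m M *m x) 0 0)).
  by rewrite mulmxBr mulmx1 mulmxBl [LHS]mxE [X in _ + X]mxE; field.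
congr (_ * _); rewrite {1}xx xx' xMx mulr_sumr -big_split -sumrB.
apply: eq_bigr => u _; rewrite mulr_sumr -big_split -sumrB.
by apply: eq_bigr => v _; rewrite /= -/(y u) -/(y v); ring.
Qed.

(** If the form vanishes at [x], the Dirichlet part makes [x u 0 / Num.sqrt (deg G u)] constant
    along edges, so by connectedness [x] is a multiple of [w]; the rank-one part makes it orthogonal
    to [w]. *)
Lemma regularized_laplacian_posdef : posdef N.
Proof.
split=> [|x x0].
  by rewrite /N linearD linearB /= trmx1 normalized_adj_sym trmx_mul trmxK.
have NE : (x^T *m N *m x) 0 0
    = (x^T *m (1%:M - M) *m x) 0 0 + ((w^T *m x) 0 0) ^+ 2.
  rewrite /N /regularized_laplacian mulmxDr mulmxDl mxE; congr (_ + _).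
  rewrite mulmxA -mulmxA -[x^T *m w]trmxK trmx_mul trmxK.
  by rewrite [X in X^T *m _]mx11_scalar tr_scalar_mx mul_scalar_mx mxE expr2.
have LE := laplacian_form x; set L := (x^T *m (1%:M - M) *m x) 0 0 in NE LE.
have term_ge0 u v : 0 <= G u v
    * (x u 0 / Num.sqrt (deg G u) - x v 0 / Num.sqrt (deg G v)) ^+ 2.
  by rewrite mulr_ge0 ?adj_ge0 // sqr_ge0.
have L_ge0 : 0 <= L.
  rewrite LE mulr_ge0 ?invr_ge0 ?ler0n // sumr_ge0 // => u _.
  exact: sumr_ge0.
rewrite NE lt0r addr_ge0 ?sqr_ge0 // andbT paddr_eq0 ?sqr_ge0 //.
apply: contra_neqN x0 => /andP[/eqP L0]; rewrite sqrf_eq0 => /eqP wx.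
have yE u v : 0 < G u v ->
    x u 0 / Num.sqrt (deg G u) = x v 0 / Num.sqrt (deg G v).
  move=> uv; move/eqP: LE; rewrite L0 eq_sym mulf_eq0 invr_eq0 pnatr_eq0 /=.
  rewrite psumr_eq0 => [/allP/(_ u (mem_index_enum _))/=|k _]; last exact: sumr_ge0.
  rewrite psumr_eq0 // => /allP/(_ v (mem_index_enum _))/=.
  by rewrite mulf_eq0 gt_eqF //= sqrf_eq0 subr_eq0 => /eqP.
have yC u v : x u 0 / Num.sqrt (deg G u) = x v 0 / Num.sqrt (deg G v).
  have /connectP[s + ->] := hG u v; elim: s u => [|k s IHs] u //= /andP[uk ks].
  by rewrite (yE u k uk) IHs.
have xw v : x = (x v 0 / Num.sqrt (deg G v) * Num.sqrt W) *: w.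
  apply/colP => u; rewrite !mxE -(yC u v); field.
  by rewrite sW_neq0 sd_neq0.
apply/colP => v; rewrite mxE; move: wx; rewrite (xw v) -scalemxAr perron_unit.
rewrite scalemx1 !mxE eqxx mulr1n => ->; by rewrite mul0r.
Qed.

Let N_unit := posdef_unitmx regularized_laplacian_posdef.
Let Z := invmx N.

Let wN : w^T *m N = w^T.
Proof.
have wM : w^T *m M = w^T.
  by rewrite -[LHS]trmxK trmx_mul trmxK normalized_adj_sym normalized_adj_perron.
rewrite /N /regularized_laplacian mulmxDr mulmxBr mulmx1 mulmxA perron_unit mul1mx.
by rewrite -/M -/w wM subrr add0r.
Qed.

Let wZ : w^T *m Z = w^T. Proof. by rewrite -{1}wN -mulmxA mulmxV // mulmx1. Qed.

Let Zw : Z *m w = w.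
Proof.
apply: trmx_inj; rewrite trmx_mul /Z trmx_inv.
by rewrite (proj1 regularized_laplacian_posdef) wZ.
Qed.

(** The row [q = p D^(-1/2)] is fixed by [M], so [q N] is a multiple of [w^T], and inverting [N]
    makes [q] itself that multiple; total mass 1 fixes the scalar. *)
Lemma stationaryE (p : 'rV[R]_n) : stationary (transition G) p ->
  forall u, p 0 u = deg G u / W.
Proof.
move=> [_ p1 pP]; pose q : 'rV[R]_n := \row_u (p 0 u / Num.sqrt (deg G u)).
have qM : q *m M = q.
  apply/rowP => v; rewrite mxE [RHS]mxE -[in RHS]pP mxE mulr_suml.
  apply: eq_bigr => u _; rewrite mxE normalized_adjE transitionE.
  by rewrite -{3}sd_sqr; field; rewrite !sd_neq0.
have qw : q *m w = (Num.sqrt W)^-1%:M.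
  rewrite [LHS]mx11_scalar; congr _%:M; rewrite mxE.
  rewrite -[RHS]mul1r -p1 mulr_suml; apply: eq_bigr => u _.
  by rewrite !mxE; field; rewrite sW_neq0 sd_neq0.
have qN : q *m N = (Num.sqrt W)^-1 *: w^T.
  rewrite /N /regularized_laplacian mulmxDr mulmxBr mulmx1 qM subrr add0r.
  by rewrite mulmxA qw mul_scalar_mx.
have qE : q = (Num.sqrt W)^-1 *: w^T.
  by rewrite -[LHS]mulmx1 -(mulmxV N_unit) mulmxA qN -scalemxAl wZ.
move=> u; have /rowP/(_ u) := qE; rewrite !mxE => quE.
rewrite -[LHS](divfK (sd_neq0 u)) quE.
have -> : deg G u / W = Num.sqrt (deg G u) ^+ 2 / Num.sqrt W ^+ 2.
  by rewrite sd_sqr sW_sqr.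
by field; rewrite sW_neq0.
Qed.

Lemma kemenyE (p : 'rV[R]_n) (j : 'I_n) : stationary (transition G) p ->
  kemeny G p j = (\tr Z - 1)%:E.
Proof.
move=> /stationaryE pE.
(* [z] is the fundamental matrix [(1 - P + 1 pi)^(-1)] of the walk, and [h i u] is the candidate for
   the mean first passage time from [u] to [i]. *)
pose z u i := Z u i * Num.sqrt (deg G i) / Num.sqrt (deg G u).
pose h i u := ((u == i)%:R + z i i - z u i) / (deg G i / W).
have pi_neq0 i : deg G i / W != 0.
  by rewrite mulf_neq0 ?invr_eq0 // gt_eqF ?deg_gt0 ?volT_gt0.
(* Entrywise form of [(1 - P) z = 1 - 1 pi], obtained from [N Z = 1] and [w^T Z = w^T]. *)
have zP u i : z u i = \sum_k transition G u k * z k i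
    + (u == i)%:R - deg G i / W.
  have /matrixP/(_ u i) : (1%:M - M) *m Z = 1%:M - w *m w^T.
    have -> : 1%:M - M = N - w *m w^T by rewrite /N /regularized_laplacian addrK.
    by rewrite mulmxBl mulmxV // -mulmxA wZ.
  rewrite mulmxBl mul1mx !mxE big_ord1 !mxE => /eqP; rewrite subr_eq => /eqP ZE.
  rewrite /z ZE.
  have -> : \sum_k transition G u k * (Z k i * Num.sqrt (deg G i) / Num.sqrt (deg G k))
     = (\sum_k M u k * Z k i) * Num.sqrt (deg G i) / Num.sqrt (deg G u).
    rewrite !mulr_suml; apply: eq_bigr => k _.
    rewrite normalized_adjE transitionE -{1}sd_sqr; field.
    by rewrite !sd_neq0.
  have -> : deg G i / W = Num.sqrt (deg G i) ^+ 2 / Num.sqrt W ^+ 2.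
    by rewrite sd_sqr sW_sqr.
  have [->|_] := eqVneq u i; rewrite ?mulr1n ?mulr0n.
    by move: (\sum_k _) => s; field; rewrite sd_neq0 sW_neq0.
  by move: (\sum_k _) => s; field; rewrite !sd_neq0 sW_neq0.
have hE i u : h i u = 1 + \sum_(k | k != i) transition G u k * h i k.
  (* The sum over all [k] is computed first; the term [k = i] is then removed, [h i i] being the
     mean return time [W / deg G i]. *)
  have : \sum_k transition G u k * h i k
      = (transition G u i + z i i - \sum_k transition G u k * z k i) / (deg G i / W).
    rewrite -[z i i in RHS]mul1r -(transition_sum1 u) mulr_suml.
    have -> : transition G u i = \sum_k transition G u k * (k == i)%:R.
      rewrite (bigD1 i) //= eqxx mulr1 big1 ?addr0 // => k /negbTE->.
      by rewrite mulr0.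
    rewrite -big_split -sumrB mulr_suml; apply: eq_bigr => k _.
    by rewrite /h /=; ring.
  rewrite (bigD1 i) //= => /eqP; rewrite addrC eq_sym -subr_eq => /eqP <-.
  have -> : h i i = (deg G i / W)^-1 by rewrite /h eqxx addrK mul1r.
  rewrite /h (zP u i).
  move: (pi_neq0 i) (\sum_k _) (z i i) (transition G u i) => + s zi t.
  by move: (deg G i / W) (_%:R) => pi b pi0; field.
rewrite /kemeny.
have -> : (\sum_i (p 0 i)%:E * mean_first_passage (transition G) j i)%E
    = (\sum_i p 0 i * h i j)%:E.
  rewrite -sumEFin; apply: eq_bigr => i _.
  rewrite (mean_first_passageE transition_ge0 transition_sum1 (h := h i)) //.
rewrite -EFinB; congr (_ - 1)%:E.
transitivity (\sum_i ((j == i)%:R + Z i i - z j i)).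
  apply: eq_bigr => i _; rewrite pE /h mulrC divfK //; congr (_ + _ - _).
  by rewrite /z mulfK.
rewrite sumrB big_split /= (bigD1 j) //= eqxx big1 => [|i]; last first.
  by rewrite eq_sym => /negbTE->.
(* Row sums of [z] are the rescaled identity [Z w = w]; they cancel the 1 coming from the indicator
   of [j == i]. *)
have -> : \sum_i z j i = 1.
  have /colP/(_ j) := Zw; rewrite !mxE => ZwE.
  transitivity ((\sum_i Z j i * w i 0) * Num.sqrt W / Num.sqrt (deg G j)).
    rewrite !mulr_suml; apply: eq_bigr => i _; rewrite mxE /z.
    by field; rewrite sW_neq0 sd_neq0.
  by rewrite ZwE; field; rewrite sW_neq0 sd_neq0.
by rewrite addr0 addrC addrK.
Qed.
End Graph.

(** * The quotient matrix *)

(** Passes to the class function of the partition; its surjectivity expresses that the parts are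
    nonempty. *)
Lemma vertex_partition_fun n m (V : 'I_m -> {set 'I_n}) :
  vertex_partition V -> exists2 f : 'I_n -> 'I_m,
    (forall u i, (u \in V i) = (f u == i)) & forall i, exists u, f u = i.
Proof.
move=> [Vinj /and3P[/eqP covV trivV V0]].
have part i : V i \in [set V i | i : 'I_m] by apply: imset_f.
have ex u : exists i, u \in V i.
  have : u \in cover [set V i | i : 'I_m] by rewrite covV inE.
  by move=> /bigcupP[_ /imsetP[i _ ->] uV]; exists i.
pose f u := xchoose (ex u).
have fE u i : (u \in V i) = (f u == i).
  apply/idP/eqP => [uV|<-]; last exact: (xchooseP (ex u)).
  have fV : u \in V (f u) := xchooseP (ex u).
  apply: Vinj; apply/eqP/negPn/negP => neq.
  have /trivIsetP/(_ _ _ (part (f u)) (part i) neq) := trivV.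
  by move=> /disjoint_setI0/setP/(_ u); rewrite !inE fV uV.
exists f => // i; have [u uV] : exists u, u \in V i.
  by apply/set0Pn; apply: contraNneq V0 => <-.
by exists u; apply/eqP; rewrite -fE.
Qed.

(** Symmetry pairs [u < v] with [v < u], and the diagonal is zero. Thus diagonal entries of the
    quotient matrix follow the same cut formula as the others. *)
Lemma double_inner_weight (R : realType) n (G : wgraph R n) (S : {set 'I_n}) :
  2 * inner_weight G S = cut_weight G S S.
Proof.
have uppE : inner_weight G S = \sum_(u in S) \sum_(v in S) if (u < v)%N then G u v else 0.
  by apply: eq_bigr => u _; rewrite big_mkcondr.
have lowE : inner_weight G S = \sum_(u in S) \sum_(v in S) if (v < u)%N then G u v else 0.
  rewrite uppE exchange_big; apply: eq_bigr => u _; apply: eq_bigr => v _.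
  by rewrite adj_sym.
rewrite mulr_natl mulr2n {1}uppE lowE -big_split; apply: eq_bigr => u _.
rewrite -big_split; apply: eq_bigr => v _ /=.
case: ltngtP => [_|_|/val_inj->]; rewrite ?addr0 ?add0r //.
by rewrite adj_loopless.
Qed.

(** A left eigenvector [y] for [x != 1] annihilates [w], so the positive form takes the value
    [1 - x] times the squared length of [y]. *)
Lemma perron_eigenvalue_lt1 (R : rcfType) n (M : 'M[R]_n) (w : 'cV[R]_n) (x : R) :
  M *m w = w -> posdef (1%:M - M + w *m w^T) -> eigenvalue M x -> x != 1 -> x < 1.
Proof.
move=> Mw [_ Np] /eigenvalueP[y yM y0] x1.
have yw : y *m w = 0.
  have : (x - 1) *: (y *m w) = 0.
    by rewrite scalerBl scale1r scalemxAl -yM -mulmxA Mw subrr.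
  by move/eqP; rewrite scaler_eq0 subr_eq0 (negbTE x1) => /eqP.
have := Np y^T; rewrite -trmx0 (inj_eq trmx_inj) => /(_ y0).
rewrite trmxK mulmxDr mulmxA yw mul0mx addr0 mulmxBr mulmx1 yM.
rewrite -{1}[y]scale1r -scalerBl -scalemxAl mxE -{1}[y]trmxK mx11_norm2.
move=> h; rewrite -subr_gt0 ltNge; apply/negP => le0.
have : (1 - x) * \sum_i y^T i 0 ^+ 2 <= 0.
  by rewrite mulr_le0_ge0 // sumr_ge0 // => i _; exact: sqr_ge0.
by rewrite leNgt h.
Qed.

(** Puts the Perron eigenvalue at index 0, so that a sum from index 1 omits exactly that one
    copy. *)
Lemma sorted_head1 (R : realDomainType) (s : seq R) :
  sorted >=%R s -> 1 \in s -> (forall x, x \in s -> x <= 1) -> s = 1 :: behead s.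
Proof.
case: s => [|x s] //= s_sorted s1 s_le1; congr (_ :: _).
apply/eqP; rewrite eq_le s_le1 ?mem_head //=.
move: s1; rewrite inE => /predU1P[->//|s1].
by have /allP/(_ 1 s1) := order_path_min (fun a b c h k => le_trans k h) s_sorted.
Qed.

Section Quotient.
Variables (R : realType) (n m : nat) (G : wgraph R n) (V : 'I_m -> {set 'I_n}).
Hypotheses (n_gt1 : (1 < n)%N) (hG : graph_connected G).
Variable f : 'I_n -> 'I_m.
Hypothesis fE : forall u i, (u \in V i) = (f u == i).
Hypothesis f_onto : forall i, exists u, f u = i.

Let M := normalized_adj G.
Let B := quotient_mx G V.
Let w := perron G.

Definition part_mx : 'M[R]_(n, m) := \matrix_(u, i)
  if f u == i then Num.sqrt (deg G u) / Num.sqrt (vol G (V i)) else 0.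

Definition quotient_perron : 'cV[R]_m :=
  \col_i (Num.sqrt (vol G (V i)) / Num.sqrt (vol G setT)).

Let S := part_mx.
Let v := quotient_perron.

Let d_gt0 := deg_gt0 n_gt1 hG.
Let sd_neq0 u : Num.sqrt (deg G u) != 0.
Proof. by rewrite gt_eqF // sqrtr_gt0. Qed.
Let sd_sqr u : Num.sqrt (deg G u) ^+ 2 = deg G u.
Proof. by rewrite sqr_sqrtr // ltW. Qed.

Let vol_gt0 i : 0 < vol G (V i).
Proof.
have [u fu] := f_onto i.
rewrite /vol (bigD1 u) /=; last by rewrite fE fu.
by rewrite ltr_pwDl // sumr_ge0 // => k _; apply/ltW.
Qed.
Let sv_neq0 i : Num.sqrt (vol G (V i)) != 0.
Proof. by rewrite gt_eqF // sqrtr_gt0. Qed.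
Let sv_sqr i : Num.sqrt (vol G (V i)) ^+ 2 = vol G (V i).
Proof. by rewrite sqr_sqrtr // ltW. Qed.

Lemma part_mx_isometry : S^T *m S = 1%:M.
Proof.
apply/matrixP => i k; rewrite !mxE.
have [<-|ik] := eqVneq i k; last first.
  rewrite big1 // => u _; rewrite !mxE.
  have [fu|_] := eqVneq (f u) i; last by rewrite mul0r.
  by rewrite fu (negbTE ik) mulr0.
transitivity (\sum_(u in V i) deg G u / vol G (V i)).
  rewrite [RHS]big_mkcond; apply: eq_bigr => u _; rewrite !mxE fE.
  case: ifP => _; last by rewrite mul0r.
  by rewrite -expr2 expr_div_n sd_sqr sv_sqr.
by rewrite -mulr_suml -/(vol G (V i)) divff // gt_eqF.
Qed.

Lemma part_mx_quotient : S^T *m M *m S = B.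
Proof.
apply/matrixP => i k.
have -> : (S^T *m M *m S) i k
    = cut_weight G (V i) (V k) / (Num.sqrt (vol G (V i)) * Num.sqrt (vol G (V k))).
  rewrite -mulmxA mxE /cut_weight mulr_suml [RHS]big_mkcond.
  apply: eq_bigr => a _; rewrite [S^T _ _]mxE [S _ _]mxE fE.
  case: ifP => _; last by rewrite mul0r.
  rewrite mxE mulr_suml mulr_sumr [RHS]big_mkcond.
  apply: eq_bigr => b _; rewrite [S _ _]mxE fE.
  case: ifP => _; last by rewrite !mulr0.
  rewrite normalized_adjE; field.
  by rewrite !sv_neq0 !sd_neq0.
rewrite mxE; case: eqP => [<-|_].
  by rewrite -expr2 sv_sqr double_inner_weight.
by rewrite sqrtrM // ltW.
Qed.

Lemma part_mx_perron : S *m v = w.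
Proof.
apply/colP => u; rewrite !mxE (bigD1 (f u)) //= !mxE eqxx big1 => [|i iu].
  by rewrite addr0 mulrA divfK.
by rewrite !mxE eq_sym (negbTE iu) mul0r.
Qed.

Lemma part_mx_tr_perron : S^T *m w = v.
Proof. by rewrite -part_mx_perron mulmxA part_mx_isometry mul1mx. Qed.

Lemma quotient_perron_unit : v^T *m v = 1%:M.
Proof.
rewrite -{1}part_mx_tr_perron trmx_mul trmxK -mulmxA part_mx_perron.
exact: perron_unit.
Qed.

Lemma quotient_mx_perron : B *m v = v.
Proof.
rewrite -part_mx_quotient -mulmxA part_mx_perron -mulmxA.
by rewrite normalized_adj_perron // part_mx_tr_perron.
Qed.

Lemma quotient_mx_sym : B^T = B.
Proof. by rewrite -part_mx_quotient 2!trmx_mul trmxK [M^T]normalized_adj_sym mulmxA. Qed.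

(** Because [w = S v] lies in the range of [S], compression turns the rank-one term into [v v^T], so
    it commutes with regularization. *)
Lemma part_mx_regularized :
  S^T *m regularized_laplacian G *m S = 1%:M - B + v *m v^T.
Proof.
have wS : w^T *m S = v^T by rewrite -part_mx_tr_perron trmx_mul trmxK.
rewrite mulmxDr mulmxDl mulmxBr mulmxBl mulmx1 part_mx_isometry part_mx_quotient.
by rewrite mulmxA part_mx_tr_perron -mulmxA wS.
Qed.

Lemma quotient_regularized_posdef : posdef (1%:M - B + v *m v^T).
Proof.
rewrite -part_mx_regularized; apply: posdef_compress part_mx_isometry.
exact: regularized_laplacian_posdef.
Qed.

(** Both rank-one terms have trace 1, and [M] has trace 0 since there are no loops. *)
Lemma compression_gap :
  \tr (regularized_laplacian G) - \tr (1%:M - B + v *m v^T)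
  = n%:R - m%:R + tau G V.
Proof.
have -> : \tr (regularized_laplacian G) = n%:R + 1.
  rewrite mxtraceD mxtrace_mulC perron_unit // mxtrace1 raddfB /= mxtrace1.
  by rewrite [\tr (normalized_adj G)]normalized_adj_tr0 subr0.
rewrite mxtraceD mxtrace_mulC quotient_perron_unit mxtrace1 raddfB /= mxtrace1.
by rewrite /tau -/B; ring.
Qed.

End Quotient.

(** * The bound on Kemeny's constant and its equality case *)

Theorem theorem3p3 (R : realType) (n m : nat) (hn : (3 <= n)%N)
    (hm : (2 <= m <= n - 1)%N)
    (G : wgraph R n) (hG : graph_connected G)
    (p : 'rV[R]_n) (hp : stationary (transition G) p) (j : 'I_n)
    (V : 'I_m -> {set 'I_n}) (hV : vertex_partition V)
    (theta : m.-tuple R) (htheta : spectrum (quotient_mx G V) theta)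
    (htheta_sorted : sorted >=%R theta)
    (lambda : n.-tuple R) (hlambda : spectrum (normalized_adj G) lambda) :
  let bound : R :=
    \sum_(1 <= i < m) 1 / (1 - theta`_i)
      + (n - m)%:R ^+ 2 / ((n - m)%:R + tau G V) in
  let rho : R := - tau G V / (n - m)%:R in
  (bound%:E <= kemeny G p j)%E
  /\ (kemeny G p j = bound%:E <-> perm_eq lambda (theta ++ nseq (n - m) rho)).
Proof.
move=> bound rho.
have n_gt1 : (1 < n)%N by apply: ltn_trans hn.
have lt_mn : (m < n)%N.
  by case/andP: hm => _; rewrite subn1 -ltnS prednK // (ltn_trans _ hn).
have [f fE f_onto] := vertex_partition_fun hV.
rewrite /spectrum in htheta hlambda.
set M := normalized_adj G in hlambda; set B := quotient_mx G V in htheta.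
set N := regularized_laplacian G; set w := perron G.
set S := part_mx G V f; set v := quotient_perron G V.
set N1 := 1%:M - B + v *m v^T.
have Np : posdef N by apply: regularized_laplacian_posdef.
have SS : S^T *m S = 1%:M by apply: part_mx_isometry.
have SNS : S^T *m N *m S = N1 by apply: part_mx_regularized.
have Sv : S *m v = w by apply: part_mx_perron.
have N1p : posdef N1 by apply: quotient_regularized_posdef.
have Bv : B *m v = v by apply: quotient_mx_perron.
have [l1 trN] := mxtrace_inv_perron (normalized_adj_sym G)
  (perron_unit n_gt1 hG) (normalized_adj_perron n_gt1 hG) hlambda (posdef_unitmx Np).
have [th1 trN1] := mxtrace_inv_perron (quotient_mx_sym n_gt1 hG fE f_onto)
  (quotient_perron_unit n_gt1 hG fE f_onto) Bv htheta (posdef_unitmx N1p).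
rewrite -/N in trN; rewrite -/B -/v -/N1 in trN1.
have theta_le1 x : x \in theta -> x <= 1.
  rewrite -root_prod_XsubC -htheta -eigenvalue_root_char => xB.
  by have [->|/(perron_eigenvalue_lt1 Bv N1p xB)/ltW] := eqVneq x 1.
have thetaE := sorted_head1 htheta_sorted th1 theta_le1.
have rem_theta : rem 1 theta = behead theta by rewrite {1}thetaE /= eqxx.
have sum_theta : \sum_(1 <= i < m) 1 / (1 - theta`_i)
    = \sum_(x <- rem 1 theta) (1 - x)^-1.
  rewrite rem_theta [RHS](big_nth 0) size_behead size_tuple.
  by rewrite big_add1; apply: eq_bigr => i _; rewrite nth_behead mul1r.
have gap : \tr N - \tr N1 = (n - m)%:R + tau G V.
  by rewrite natrB ?(ltnW lt_mn) //; apply: compression_gap.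
have := mxtrace_inv_compress Np SS lt_mn; rewrite /= SNS gap trN1.
set a := _ + tau G V => -[a_gt0 le_tr eq_tr].
have bE : bound = \sum_(x <- rem 1 theta) (1 - x)^-1 + (n - m)%:R ^+ 2 / a.
  by rewrite /bound sum_theta.
rewrite (kemenyE n_gt1 hG) // -/N.
have r0 : (n - m)%:R != 0 :> R by rewrite pnatr_eq0 subn_eq0 -ltnNge.
split; first by rewrite lee_fin bE; lra.
split=> [[/eqP]|perm_lambda].
  rewrite subr_eq bE => /eqP trE.
  have NE : N = S *m N1 *m S^T + (a / (n - m)%:R) *: (1%:M - S *m S^T).
    by apply: eq_tr; rewrite trE; ring.
  (* Undo the regularization: [S v v^T S^T] is [w w^T], which cancels, and [1 - a / (n - m)] is
     [rho]. *)
  have ME : M = S *m B *m S^T + rho *: (1%:M - S *m S^T).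
    have -> : M = 1%:M + w *m w^T - N.
      by rewrite /N /regularized_laplacian -/M -/w opprD addrACA subrr addr0 opprB addrC subrK.
    have -> : rho = 1 - a / (n - m)%:R by rewrite /rho /a; field.
    rewrite NE /N1 mulmxDr mulmxDl mulmxBr mulmxBl mulmx1 mulmxA Sv.
    rewrite -[w *m v^T *m S^T]mulmxA -trmx_mul Sv scalerBl scale1r.
    move: (S *m S^T) (S *m B *m S^T) (w *m w^T) => X Y z.
    move: (_ *: _) => e.
    apply/matrixP => s t; rewrite !mxE; ring.
  apply: prod_XsubC_inj; rewrite -hlambda ME char_poly_isometry ?(ltnW lt_mn) //.
  by rewrite htheta big_cat /= big_nseq iter_mulr_1.
(* Conversely, once one eigenvalue 1 is removed from each spectrum, they differ by [n - m] copies of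
   [rho], each contributing [1 / (1 - rho) = (n - m) / a]. *)
congr (_%:E); rewrite bE trN.
have rem_lambda : perm_eq (rem 1 lambda) (behead theta ++ nseq (n - m) rho).
  by rewrite -(perm_cons 1) -(permPl (perm_to_rem l1)) -cat_cons -thetaE.
rewrite (perm_big _ rem_lambda) big_cat /= rem_theta [LHS]addrC addKr; congr (_ + _).
rewrite big_nseq iter_addr addr0 -[LHS]mulr_natl.
have a0 : a != 0 by rewrite gt_eqF.
have -> : 1 - rho = a / (n - m)%:R by rewrite /rho /a; field.
by field; rewrite a0 r0.
Qed.
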